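(* Let $\mathcal C$ be a strong balanced factorization category. (i) For every object $X$ of $\mathcal C$ there are isomorphisms $$ n\,\bar\otimes_X\, p \;\cong\; n\otimes_X {\downarrow_X} p $$ natural in $n\in\mathcal M'/X$ and $p\in\mathcal C/X$. (ii) For every morphism $f:X\to Y$ of $\mathcal C$ there are isomorphisms $$ f^*n\otimes_X m \;\cong\; n\otimes_Y \exists_f m $$ natural in $m\in\mathcal M/X$ and $n\in\mathcal M'/Y$. (iii) If $e:X\to Y$ is in $\mathcal E$, then there are isomorphisms $$ e^*n\otimes_X 1_X\;\cong\; n\otimes_Y 1_Y $$ natural in $n\in\mathcal M'/Y$.
   Context: A balanced factorization category (bfc) is a finitely complete category $\mathcal C$ with two (orthogonal) factorization systems $(\mathcal E,\mathcal M)$ and $(\mathcal E',\mathcal M')$ satisfying the reciprocal stability law: the pullback of a map in $\mathcal E$ along a map in $\mathcal M'$ is in $\mathcal E$, and the pullback of a map in $\mathcal E'$ along a map in $\mathcal M$ is in $\mathcal E'$. For an object $X$, $\mathcal M/X$ (resp. $\mathcal M'/X$) is the full subcategory of $\mathcal C/X$ on the objects $A\to X$ lying in $\mathcal M$ (resp. $\mathcal M'$). The bfc is strong if $\mathcal M/1=\mathcal M'/1$; this category is denoted $\mathcal S$. For $f:X\to Y$, $f^*$ denotes pullback along $f$ (it restricts to $\mathcal M/Y\to\mathcal M/X$ and $\mathcal M'/Y\to\mathcal M'/X$), and $\exists_f:\mathcal M/X\to\mathcal M/Y$ is the left adjoint of $f^*:\mathcal M/Y\to\mathcal M/X$; $\exists_f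 m$ is the second factor of an $(\mathcal E,\mathcal M)$-factorization of $f\circ m$. For $p\in\mathcal C/X$, $\downarrow_X p\in\mathcal M/X$ is the reflection of $p$ in $\mathcal M/X$, i.e. the second factor of an $(\mathcal E,\mathcal M)$-factorization of $p$. The functor $\pi_0:\mathcal C\to\mathcal S$ is the left adjoint of the inclusion $\mathcal S\hookrightarrow\mathcal C$. For $p:P\to X$ and $q:Q\to X$ in $\mathcal C/X$, $p\,\bar\otimes_X\,q:=\pi_0(P\times_X Q)\in\mathcal S$; this defines a functor $\bar\otimes_X:\mathcal C/X\times\mathcal C/X\to\mathcal S$, and $\otimes_X:\mathcal M'/X\times\mathcal M/X\to\mathcal S$ is its restriction. $1_X$ is the identity of $X$, i.e. the terminal object of $\mathcal C/X$ (it lies in both $\mathcal M/X$ and $\mathcal M'/X$). *)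

(* Defs.v *)
From Stdlib Require Import ProofIrrelevance IndefiniteDescription.

Set Implicit Arguments.
Unset Strict Implicit.
Unset Printing Implicit Defensive.

Record category := Category {
  ob :> Type;
  hom : ob -> ob -> Type;
  idm : forall X, hom X X;
  comp : forall X Y Z, hom Y Z -> hom X Y -> hom X Z;
  comp_idl : forall X Y (f : hom X Y), comp (idm Y) f = f;
  comp_idr : forall X Y (f : hom X Y), comp f (idm X) = f;
  comp_assoc : forall W X Y Z (h : hom Y Z) (g : hom X Y) (f : hom W X),
    comp h (comp g f) = comp (comp h g) f
}.

Arguments hom {c} X Y.
Arguments idm {c} X.
Arguments comp {c X Y Z} g f.

Notation "g ∘ f" := (comp g f) (at level 40, left associativity).

Definition is_iso (C : category) (X Y : C) (f : hom X Y) : Prop :=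
  exists g : hom Y X, g ∘ f = idm X /\ f ∘ g = idm Y.

Record functor (A B : category) := Functor {
  fob :> A -> B;
  fmap : forall X Y : A, hom X Y -> hom (fob X) (fob Y);
  fmap_id : forall X : A, fmap (idm X) = idm (fob X);
  fmap_comp : forall (X Y Z : A) (g : hom Y Z) (f : hom X Y),
    fmap (g ∘ f) = fmap g ∘ fmap f
}.

Arguments fmap {A B} F {X Y} f : rename.

Definition functor_id (A : category) : functor A A :=
  {| fob := fun X => X;
     fmap := fun X Y f => f;
     fmap_id := fun X => eq_refl;
     fmap_comp := fun X Y Z g f => eq_refl |}.

Program Definition functor_comp (A B D : category)
    (G : functor B D) (F : functor A B) : functor A D :=
  {| fob := fun X => G (F X);
     fmap := fun X Y f => fmap G (fmap F f) |}.
Next Obligation. now rewrite !fmap_id. Qed.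
Next Obligation. now rewrite !fmap_comp. Qed.

Notation "G ⊚ F" := (functor_comp G F) (at level 40, left associativity).

Program Definition functor_const (A B : category) (b : B) : functor A B :=
  {| fob := fun _ => b; fmap := fun _ _ _ => idm b |}.
Next Obligation. now rewrite comp_idl. Qed.

Arguments functor_const A {B} b.

Definition naturally_isomorphic (A B : category) (F G : functor A B) : Prop :=
  exists a : forall X : A, hom (F X) (G X),
    (forall X, is_iso (a X)) /\
    (forall (X Y : A) (f : hom X Y), fmap G f ∘ a X = a Y ∘ fmap F f).

Notation "F ≅ G" := (naturally_isomorphic F G) (at level 70).

Record adjunction (A B : category) (L : functor A B) (R : functor B A) := {
  transpose : forall (a : A) (b : B), hom (L a) b -> hom a (R b);
  untranspose : forall (a : A) (b : B), hom a (R b) -> hom (L a) b;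
  transposeK : forall a b (h : hom (L a) b), untranspose (transpose h) = h;
  untransposeK : forall a b (g : hom a (R b)), transpose (untranspose g) = g;
  transpose_natural :
    forall (a a' : A) (b b' : B) (s : hom a' a) (t : hom b b') (h : hom (L a) b),
      transpose (t ∘ h ∘ fmap L s) = fmap R t ∘ transpose h ∘ s
}.

Program Definition prod_cat (A B : category) : category :=
  {| ob := (A * B)%type;
     hom := fun x y => (hom (fst x) (fst y) * hom (snd x) (snd y))%type;
     idm := fun x => (idm (fst x), idm (snd x));
     comp := fun x y z g f => (fst g ∘ fst f, snd g ∘ snd f) |}.
Next Obligation. simpl. now rewrite !comp_idl. Qed.
Next Obligation. simpl. now rewrite !comp_idr. Qed.
Next Obligation. simpl. now rewrite !comp_assoc. Qed.

Notation "A ⨉ B" := (prod_cat A B) (at level 40, left associativity).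

Program Definition functor_pair (A B D : category)
    (F : functor A B) (G : functor A D) : functor A (B ⨉ D) :=
  {| fob := fun x => ((F x, G x) : B ⨉ D);
     fmap := fun x y f => (fmap F f, fmap G f) |}.
Next Obligation. now rewrite !fmap_id. Qed.
Next Obligation. now rewrite !fmap_comp. Qed.

Program Definition functor_prod (A A' B B' : category)
    (F : functor A B) (G : functor A' B') : functor (A ⨉ A') (B ⨉ B') :=
  {| fob := fun x => ((F (fst x), G (snd x)) : B ⨉ B');
     fmap := fun x y f => (fmap F (fst f), fmap G (snd f)) |}.
Next Obligation. now rewrite !fmap_id. Qed.
Next Obligation. now rewrite !fmap_comp. Qed.

Definition full_sub (A : category) (P : A -> Prop) : category :=
  {| ob := {x : A | P x};
     hom := fun x y => hom (proj1_sig x) (proj1_sig y);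
     idm := fun x => idm (proj1_sig x);
     comp := fun x y z g f => g ∘ f;
     comp_idl := fun x y f => comp_idl f;
     comp_idr := fun x y f => comp_idr f;
     comp_assoc := fun w x y z h g f => comp_assoc h g f |}.

Definition full_incl (A : category) (P : A -> Prop) : functor (full_sub P) A :=
  {| fob := fun x : full_sub P => proj1_sig x;
     fmap := fun x y f => f;
     fmap_id := fun x => eq_refl;
     fmap_comp := fun x y z g f => eq_refl |}.

Definition restrict (A B : category) (P : A -> Prop) (Q : B -> Prop)
    (F : functor A B) (H : forall x, P x -> Q (F x)) :
    functor (full_sub P) (full_sub Q) :=
  {| fob := fun x : full_sub P =>
       (exist Q (F (proj1_sig x)) (H _ (proj2_sig x)) : full_sub Q);
     fmap := fun x y f => fmap F f;
     fmap_id := fun x => fmap_id F (proj1_sig x);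
     fmap_comp := fun x y z g f => fmap_comp F g f |}.

Record slice_ob (C : category) (X : C) := SliceOb {
  sdom : C;
  smap : hom sdom X
}.

Arguments SliceOb {C X sdom} smap.

Definition slice_hom (C : category) (X : C) (p q : slice_ob X) :=
  {h : hom (sdom p) (sdom q) | smap q ∘ h = smap p}.

Lemma slice_hom_eq (C : category) (X : C) (p q : slice_ob X) (g h : slice_hom p q) :
  proj1_sig g = proj1_sig h -> g = h.
Proof.
  destruct g as [g Hg], h as [h Hh]; simpl; intros ->.
  f_equal; apply proof_irrelevance.
Qed.

Program Definition slice (C : category) (X : C) : category :=
  {| ob := slice_ob X;
     hom := @slice_hom C X;
     idm := fun p => exist _ (idm (sdom p)) _;
     comp := fun p q r g f => exist _ (proj1_sig g ∘ proj1_sig f) _ |}.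
Next Obligation. apply comp_idr. Qed.
Next Obligation.
  destruct g as [g Hg], f as [f Hf]; simpl.
  now rewrite comp_assoc, Hg.
Qed.
Next Obligation. apply slice_hom_eq; apply comp_idl. Qed.
Next Obligation. apply slice_hom_eq; apply comp_idr. Qed.
Next Obligation. apply slice_hom_eq; apply comp_assoc. Qed.

Arguments slice {C} X.

Definition slice_dom (C : category) (X : C) : functor (slice X) C :=
  {| fob := fun p : slice X => sdom p;
     fmap := fun (p q : slice X) (h : hom p q) => proj1_sig h;
     fmap_id := fun p => eq_refl;
     fmap_comp := fun p q r g f => eq_refl |}.

Definition is_terminal (C : category) (T : C) : Prop :=
  forall X : C, exists! f : hom X T, True.

Record is_pullback (C : category) (A B X P : C)
    (f : hom A X) (g : hom B X) (p : hom P A) (q : hom P B) : Prop := {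
  pullback_comm : f ∘ p = g ∘ q;
  pullback_univ : forall (T : C) (a : hom T A) (b : hom T B), f ∘ a = g ∘ b ->
    exists! h : hom T P, p ∘ h = a /\ q ∘ h = b
}.

(** A terminal object and pullbacks suffice for all finite limits; they are
    chosen, so that base change and fibre products are functors without further
    choices. *)
Record finite_limits (C : category) := {
  one : C;
  one_terminal : is_terminal one;
  pb : forall (A B X : C), hom A X -> hom B X -> C;
  pr1 : forall (A B X : C) (f : hom A X) (g : hom B X), hom (pb f g) A;
  pr2 : forall (A B X : C) (f : hom A X) (g : hom B X), hom (pb f g) B;
  pb_pullback : forall (A B X : C) (f : hom A X) (g : hom B X),
    is_pullback f g (pr1 f g) (pr2 f g)
}.

Section Pullback.

Variables (C : category) (L : finite_limits C).

Definition pb_lift (A B X T : C) (f : hom A X) (g : hom B X)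
    (a : hom T A) (b : hom T B) (E : f ∘ a = g ∘ b) : hom T (pb L f g) :=
  proj1_sig (constructive_definite_description _
    (pullback_univ (pb_pullback L f g) E)).

Lemma pr1_lift (A B X T : C) (f : hom A X) (g : hom B X)
    (a : hom T A) (b : hom T B) (E : f ∘ a = g ∘ b) :
  pr1 L f g ∘ pb_lift E = a.
Proof.
  unfold pb_lift; destruct constructive_definite_description as [h [H1 H2]]; exact H1.
Qed.

Lemma pr2_lift (A B X T : C) (f : hom A X) (g : hom B X)
    (a : hom T A) (b : hom T B) (E : f ∘ a = g ∘ b) :
  pr2 L f g ∘ pb_lift E = b.
Proof.
  unfold pb_lift; destruct constructive_definite_description as [h [H1 H2]]; exact H2.
Qed.

Lemma pb_ext (A B X T : C) (f : hom A X) (g : hom B X) (h k : hom T (pb L f g)) :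
  pr1 L f g ∘ h = pr1 L f g ∘ k -> pr2 L f g ∘ h = pr2 L f g ∘ k -> h = k.
Proof.
  intros H1 H2.
  assert (E : f ∘ (pr1 L f g ∘ k) = g ∘ (pr2 L f g ∘ k)).
  { rewrite !comp_assoc. now rewrite (pullback_comm (pb_pullback L f g)). }
  destruct (pullback_univ (pb_pullback L f g) E) as [u [_ Hu]].
  transitivity u; [symmetry|]; apply Hu; auto.
Qed.

Lemma fibre_product_comm (X : C) (p q p' q' : slice X) (u : hom p p') (v : hom q q') :
  smap p' ∘ (proj1_sig u ∘ pr1 L (smap p) (smap q)) =
  smap q' ∘ (proj1_sig v ∘ pr2 L (smap p) (smap q)).
Proof.
  rewrite !comp_assoc, (proj2_sig u), (proj2_sig v).
  apply (pullback_comm (pb_pullback L (smap p) (smap q))).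
Qed.

Program Definition fibre_product (X : C) : functor (slice X ⨉ slice X) C :=
  {| fob := fun x : slice X ⨉ slice X => pb L (smap (fst x)) (smap (snd x));
     fmap := fun x y f => pb_lift (fibre_product_comm (fst f) (snd f)) |}.
Next Obligation.
  apply pb_ext; rewrite ?pr1_lift, ?pr2_lift, comp_idr; apply comp_idl.
Qed.
Next Obligation.
  apply pb_ext; simpl.
  - now rewrite comp_assoc, !pr1_lift, <- !comp_assoc, pr1_lift.
  - now rewrite comp_assoc, !pr2_lift, <- !comp_assoc, pr2_lift.
Qed.

Lemma base_change_comm (X Y : C) (f : hom X Y) (p q : slice Y) (u : hom p q) :
  f ∘ pr1 L f (smap p) = smap q ∘ (proj1_sig u ∘ pr2 L f (smap p)).
Proof.
  rewrite comp_assoc, (proj2_sig u).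
  apply (pullback_comm (pb_pullback L f (smap p))).
Qed.

Program Definition base_change (X Y : C) (f : hom X Y) : functor (slice Y) (slice X) :=
  {| fob := fun p : slice Y => (SliceOb (pr1 L f (smap p)) : slice X);
     fmap := fun p q u => exist _ (pb_lift (base_change_comm f u)) _ |}.
Next Obligation. apply pr1_lift. Qed.
Next Obligation.
  apply slice_hom_eq, pb_ext; simpl; rewrite ?pr1_lift, ?pr2_lift, comp_idr; auto.
  apply comp_idl.
Qed.
Next Obligation.
  apply slice_hom_eq, pb_ext; simpl.
  - now rewrite comp_assoc, !pr1_lift.
  - now rewrite comp_assoc, !pr2_lift, <- !comp_assoc, pr2_lift.
Qed.

End Pullback.

Definition morphism_class (C : category) := forall X Y : C, hom X Y -> Prop.

Definition orthogonal (C : category) (A B X Y : C) (e : hom A B) (m : hom X Y) : Prop :=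
  forall (u : hom A X) (v : hom B Y), m ∘ u = v ∘ e ->
    exists! d : hom B X, d ∘ e = u /\ m ∘ d = v.

Record factorization_system (C : category) (E M : morphism_class C) : Prop := {
  fs_left : forall (A B : C) (e : hom A B), E A B e <->
    (forall (X Y : C) (m : hom X Y), M X Y m -> orthogonal e m);
  fs_right : forall (X Y : C) (m : hom X Y), M X Y m <->
    (forall (A B : C) (e : hom A B), E A B e -> orthogonal e m);
  fs_factor : forall (X Y : C) (f : hom X Y),
    exists (Z : C) (e : hom X Z) (m : hom Z Y), E X Z e /\ M Z Y m /\ f = m ∘ e
}.

Lemma fs_right_id (C : category) (E M : morphism_class C) :
  factorization_system E M -> forall X : C, M X X (idm X).
Proof.
  intros F X. apply (fs_right F). intros A B e _ u v H. rewrite comp_idl in H.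
  exists v. split; [split; [easy | apply comp_idl]|].
  intros d [_ H2]. now rewrite comp_idl in H2.
Qed.

Lemma fs_right_base_change (C : category) (L : finite_limits C) (E M : morphism_class C) :
  factorization_system E M ->
  forall (X Y : C) (f : hom X Y) (p : slice Y),
    M _ _ (smap p) -> M _ _ (smap (base_change L f p)).
Proof.
  intros F X Y f p Hp. apply (fs_right F). intros A B e He u v H. simpl in *.
  pose proof (pullback_comm (pb_pullback L f (smap p))) as Hsq.
  assert (H' : smap p ∘ (pr2 L f (smap p) ∘ u) = (f ∘ v) ∘ e).
  { now rewrite comp_assoc, <- Hsq, <- !comp_assoc, H. }
  destruct (proj1 (fs_right F _) Hp _ _ _ He _ _ H') as [d [[D1 D2] D3]].
  assert (E1 : f ∘ v = smap p ∘ d) by now symmetry.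
  exists (pb_lift L E1). split.
  - split; [|apply pr1_lift].
    apply pb_ext with (f := f) (g := smap p); rewrite comp_assoc.
    + now rewrite pr1_lift.
    + now rewrite pr2_lift.
  - intros k [K1 K2].
    apply pb_ext with (f := f) (g := smap p).
    + now rewrite pr1_lift, K2.
    + rewrite pr2_lift. apply D3. split.
      * now rewrite <- comp_assoc, K1.
      * now rewrite comp_assoc, <- Hsq, <- comp_assoc, K2.
Qed.

Record bfc := Bfc {
  bfc_cat :> category;
  bfc_lim : finite_limits bfc_cat;
  clsE : morphism_class bfc_cat;
  clsM : morphism_class bfc_cat;
  clsE' : morphism_class bfc_cat;
  clsM' : morphism_class bfc_cat;
  bfc_fs : factorization_system clsE clsM;
  bfc_fs' : factorization_system clsE' clsM';
  reciprocal_stability :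
    forall (A B X P : bfc_cat) (f : hom A X) (g : hom B X) (p : hom P A) (q : hom P B),
      is_pullback f g p q -> clsE f -> clsM' g -> clsE q;
  reciprocal_stability' :
    forall (A B X P : bfc_cat) (f : hom A X) (g : hom B X) (p : hom P A) (q : hom P B),
      is_pullback f g p q -> clsE' f -> clsM g -> clsE' q
}.

Arguments clsE {b X Y} f : rename.
Arguments clsM {b X Y} f : rename.
Arguments clsE' {b X Y} f : rename.
Arguments clsM' {b X Y} f : rename.

Definition terminal_ob (C : bfc) : C := one (bfc_lim C).

Definition strong (C : bfc) : Prop :=
  forall (A : C) (t : hom A (terminal_ob C)), clsM t <-> clsM' t.

Section Bfc.

Variable C : bfc.

Definition sliceM (X : C) : category := @full_sub (slice X) (fun p => clsM (smap p)).
Definition sliceM' (X : C) : category := @full_sub (slice X) (fun p => clsM' (smap p)).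

Definition inclM (X : C) : functor (sliceM X) (slice X) := full_incl _.
Definition inclM' (X : C) : functor (sliceM' X) (slice X) := full_incl _.

Definition catS : category := sliceM (terminal_ob C).

Definition inclS : functor catS C := slice_dom _ ⊚ inclM (terminal_ob C).

Definition pullbackM (X Y : C) (f : hom X Y) : functor (sliceM Y) (sliceM X) :=
  restrict (fs_right_base_change (bfc_lim C) (bfc_fs C) f).

Definition pullbackM' (X Y : C) (f : hom X Y) : functor (sliceM' Y) (sliceM' X) :=
  restrict (fs_right_base_change (bfc_lim C) (bfc_fs' C) f).

Definition identM (X : C) : sliceM X :=
  exist _ (SliceOb (idm X)) (fs_right_id (bfc_fs C) X).

Definition tensor_bar (pi0 : functor C catS) (X : C) :
    functor (slice X ⨉ slice X) catS :=
  pi0 ⊚ fibre_product (bfc_lim C) X.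

Definition tensor (pi0 : functor C catS) (X : C) :
    functor (sliceM' X ⨉ sliceM X) catS :=
  tensor_bar pi0 X ⊚ functor_prod (inclM' X) (inclM X).

End Bfc.

(** A left adjoint is only determined up to isomorphism, so the theorem takes
    π₀, ↓_X and ∃_f to be arbitrary functors equipped with an adjunction.  Such
    functors exist in any bfc: [down_exists], [exists_along_exists] and
    [pi0_exists]. *)

Lemma adjoint_of_universal_arrows (A B : category) (R : functor B A) :
  (forall a : A, exists (l : B) (u : hom a (R l)),
     forall (b : B) (g : hom a (R b)), exists! h : hom l b, fmap R h ∘ u = g) ->
  exists L : functor A B, inhabited (adjunction L R).
Proof.
  intros H.
  assert (H' : forall a : A, inhabited {l : B & {u : hom a (R l) |
     forall (b : B) (g : hom a (R b)), exists! h : hom l b, fmap R h ∘ u = g}}).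
  { intros a; destruct (H a) as [l [u Hu]]; constructor; exists l, u; exact Hu. }
  clear H.
  assert (W : forall a : A, {l : B & {u : hom a (R l) |
     forall (b : B) (g : hom a (R b)), exists! h : hom l b, fmap R h ∘ u = g}}).
  { intros a.
    refine (proj1_sig (constructive_indefinite_description (fun _ => True) _)).
    destruct (H' a) as [w]; now exists w. }
  clear H'.
  pose (l a := projT1 (W a)).
  pose (u a := proj1_sig (projT2 (W a)) : hom a (R (l a))).
  assert (Hu : forall a b (g : hom a (R b)),
    exists! h : hom (l a) b, fmap R h ∘ u a = g)
    by (intros a; exact (proj2_sig (projT2 (W a)))).
  clearbody u; clearbody l; clear W.
  pose (t a b (g : hom a (R b)) :=
    proj1_sig (constructive_definite_description _ (Hu a b g))).
  assert (Ht : forall a b (g : hom a (R b)), fmap R (t a b g) ∘ u a = g)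
    by (intros a b g; exact (proj2_sig (constructive_definite_description _ (Hu a b g)))).
  clearbody t.
  assert (Hx : forall a b (h k : hom (l a) b),
    fmap R h ∘ u a = fmap R k ∘ u a -> h = k).
  { intros a b h k E. destruct (Hu a b (fmap R k ∘ u a)) as [w [_ Hw]].
    transitivity w; [symmetry|]; now apply Hw. }
  assert (Li : forall a, t a (l a) (u a ∘ idm a) = idm (l a)).
  { intros a; apply Hx. now rewrite Ht, comp_idr, fmap_id, comp_idl. }
  assert (Lc : forall (a b c : A) (g : hom b c) (f : hom a b),
    t a (l c) (u c ∘ (g ∘ f)) = t b (l c) (u c ∘ g) ∘ t a (l b) (u b ∘ f)).
  { intros a b c g f; apply Hx.
    now rewrite Ht, fmap_comp, <- comp_assoc, Ht, !comp_assoc, Ht. }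
  exists (@Functor A B l (fun a a' s => t a (l a') (u a' ∘ s)) Li Lc).
  constructor.
  unshelve eapply (@Build_adjunction A B (Functor Li Lc) R
    (fun a b h => fmap R h ∘ u a) t); simpl.
  - intros a b h; apply Hx; apply Ht.
  - intros a b g; apply Ht.
  - intros a a' b b' s k h.
    now rewrite !fmap_comp, <- !comp_assoc, Ht.
Qed.

Lemma terminal_eq (C : bfc) (A : C) (f g : hom A (terminal_ob C)) : f = g.
Proof.
  destruct (one_terminal (bfc_lim C) A) as [h [_ Hh]].
  transitivity h; [symmetry|]; now apply Hh.
Qed.

Lemma down_exists (C : bfc) (X : C) :
  exists down : functor (slice X) (sliceM X), inhabited (adjunction down (inclM X)).
Proof.
  apply adjoint_of_universal_arrows. intros p.
  destruct (fs_factor (bfc_fs C) (smap p)) as [Z [e [m [He [Hm Hf]]]]].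
  exists (exist _ (SliceOb m) Hm : sliceM X).
  exists (exist _ e (eq_sym Hf)).
  intros [q Hq] [g Hg]; simpl in *.
  assert (E : smap q ∘ g = m ∘ e) by congruence.
  destruct (proj1 (fs_left (bfc_fs C) e) He _ _ _ Hq _ _ E) as [d [[D1 D2] D3]].
  exists (exist _ d D2). split.
  - now apply slice_hom_eq.
  - intros [k Hk] K; apply slice_hom_eq; simpl in *.
    apply D3; split; [|exact Hk]. exact (f_equal (@proj1_sig _ _) K).
Qed.

Lemma exists_along_exists (C : bfc) (X Y : C) (f : hom X Y) :
  exists ex : functor (sliceM X) (sliceM Y), inhabited (adjunction ex (pullbackM f)).
Proof.
  apply adjoint_of_universal_arrows. intros [p Hp].
  destruct (fs_factor (bfc_fs C) (f ∘ smap p)) as [Z [e [m [He [Hm Hf]]]]].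
  exists (exist _ (SliceOb m) Hm : sliceM Y).
  unshelve eexists.
  { exists (pb_lift (bfc_lim C) Hf). apply pr1_lift. }
  intros [q Hq] [g Hg]; simpl in *.
  set (P := pr2 (bfc_lim C) f (smap q)).
  pose proof (pullback_comm (pb_pullback (bfc_lim C) f (smap q))) as Hsq.
  assert (E : smap q ∘ (P ∘ g) = m ∘ e).
  { unfold P. now rewrite comp_assoc, <- Hsq, <- comp_assoc, Hg. }
  destruct (proj1 (fs_left (bfc_fs C) e) He _ _ _ Hq _ _ E) as [d [[D1 D2] D3]].
  exists (exist _ d D2). split.
  - apply slice_hom_eq, pb_ext; simpl; rewrite comp_assoc.
    + now rewrite !pr1_lift.
    + now rewrite pr2_lift, <- comp_assoc, pr2_lift.
  - intros [k Hk] K; apply slice_hom_eq; simpl in *.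
    apply D3; split; [|exact Hk].
    apply (f_equal (@proj1_sig _ _)) in K; simpl in K.
    unfold P; rewrite <- K, comp_assoc, pr2_lift, <- comp_assoc, pr2_lift.
    reflexivity.
Qed.

Lemma pi0_exists (C : bfc) :
  exists pi0 : functor C (catS C), inhabited (adjunction pi0 (inclS C)).
Proof.
  apply adjoint_of_universal_arrows. intros X.
  destruct (one_terminal (bfc_lim C) X) as [t _].
  destruct (fs_factor (bfc_fs C) t) as [Z [e [m [He [Hm Hf]]]]].
  exists (exist _ (SliceOb m) Hm : catS C), e.
  intros [q Hq] g; simpl in *.
  destruct (proj1 (fs_left (bfc_fs C) e) He _ _ _ Hq g m (terminal_eq _ _))
    as [d [[D1 D2] D3]].
  exists (exist _ d D2). split; [exact D1|].
  intros [k Hk] K; apply slice_hom_eq; simpl in *. now apply D3.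
Qed.

(* Main.v *)
(** The functor π₀ inverts every map of E, because such maps are orthogonal to
    objects of M/1.  The units of ↓_X and of ∃_f have their underlying maps in E,
    and reciprocal stability keeps them in E after pulling back along a map of M'.
    All three isomorphisms are π₀ applied to such a pulled-back map; (i) is the
    case of a base change along the identity, (iii) that of the square from
    [idm X] to [idm Y] with top and bottom [e]. *)

Require Import Defs.

Set Implicit Arguments.
Unset Strict Implicit.

(** * Units of adjunctions, and morphisms inverted by a left adjoint *)

Section Adjunction.

Variables (A B : category) (L : functor A B) (R : functor B A).
Variable adj : adjunction L R.

Definition adj_unit (a : A) : hom a (R (L a)) := transpose adj (idm (L a)).

Lemma transpose_precomp (a a' : A) (b : B) (s : hom a' a) (h : hom (L a) b) :
  transpose adj (h ∘ fmap L s) = transpose adj h ∘ s.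
Proof.
  rewrite <- (comp_idl h) at 1.
  now rewrite transpose_natural, fmap_id, comp_idl.
Qed.

Lemma transpose_unit (a : A) (b : B) (h : hom (L a) b) :
  transpose adj h = fmap R h ∘ adj_unit a.
Proof.
  pose proof (transpose_natural adj (idm a) h (idm (L a))) as H.
  now rewrite fmap_id, !comp_idr in H.
Qed.

Lemma transpose_inj (a : A) (b : B) (h k : hom (L a) b) :
  transpose adj h = transpose adj k -> h = k.
Proof.
  intros H. now rewrite <- (transposeK adj h), H, transposeK.
Qed.

Lemma adj_unit_natural (a a' : A) (s : hom a a') :
  fmap R (fmap L s) ∘ adj_unit a = adj_unit a' ∘ s.
Proof.
  rewrite <- transpose_unit. unfold adj_unit.
  now rewrite <- transpose_precomp, comp_idl.
Qed.

Lemma adj_unit_universal (a : A) (b : B) (g : hom a (R b)) :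
  exists! h : hom (L a) b, fmap R h ∘ adj_unit a = g.
Proof.
  exists (untranspose adj g). split.
  - now rewrite <- transpose_unit, untransposeK.
  - intros k K. apply transpose_inj. now rewrite untransposeK, transpose_unit.
Qed.

(** A Yoneda argument: precomposition with [s] is bijective on maps into every [R b], hence so is
    precomposition with [fmap L s] on maps into every [b]. The inverse is the transpose of the
    extension along [s] of the unit at [a']. *)
Lemma left_adjoint_inverts (a a' : A) (s : hom a' a) :
  (forall (b : B) (g : hom a' (R b)), exists! h : hom a (R b), h ∘ s = g) ->
  is_iso (fmap L s).
Proof.
  intros H. destruct (H _ (adj_unit a')) as [h [Hh _]].
  assert (K : untranspose adj h ∘ fmap L s = idm (L a')).
  { apply transpose_inj. now rewrite transpose_precomp, untransposeK. }
  exists (untranspose adj h). split; [exact K|].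
  (* Both transposes extend [transpose adj (fmap L s)] along [s], and such an extension is
     unique. *)
  apply transpose_inj.
  destruct (H _ (transpose adj (fmap L s))) as [w [_ Hw]].
  transitivity w; [symmetry|]; apply Hw; rewrite <- transpose_precomp.
  - now rewrite <- comp_assoc, K, comp_idr.
  - now rewrite comp_idl.
Qed.

End Adjunction.

(** * Pullback squares and stability of right classes *)

Lemma is_pullback_idm (C : category) (A X : C) (n : hom A X) :
  is_pullback (idm X) n n (idm A).
Proof.
  split; [now rewrite comp_idl, comp_idr|].
  intros T a b E. rewrite comp_idl in E.
  exists b. split; [split; [easy | apply comp_idl]|].
  intros k [_ K]. now rewrite comp_idl in K.
Qed.

(** The diagonal filler for [f] against [c], paired with [v], induces the filler for [q]. Here the
    square need not be a chosen one, and the stable map may be either leg. *)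
Lemma fs_right_pullback (C : category) (E M : morphism_class C) :
  factorization_system E M ->
  forall (A B X P : C) (f : hom A X) (g : hom B X) (p : hom P A) (q : hom P B),
    is_pullback f g p q -> M _ _ f -> M _ _ q.
Proof.
  intros F A B X P f g p q PB Mf. apply (fs_right F). intros S T c Ec u v H.
  pose proof (pullback_comm PB) as Sq.
  assert (H' : f ∘ (p ∘ u) = (g ∘ v) ∘ c)
    by now rewrite comp_assoc, Sq, <- !comp_assoc, H.
  destruct (proj1 (fs_right F f) Mf _ _ _ Ec _ _ H') as [d [[D1 D2] D3]].
  destruct (pullback_univ PB D2) as [w [[W1 W2] W3]].
  exists w. split; [split; [|exact W2]|].
  - assert (HU : f ∘ (p ∘ u) = g ∘ (q ∘ u)) by now rewrite !comp_assoc, Sq.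
    destruct (pullback_univ PB HU) as [z [_ Z]].
    transitivity z; [symmetry|]; apply Z; split; try easy; rewrite comp_assoc.
    + now rewrite W1.
    + now rewrite W2, H.
  - intros k [K1 K2]. apply W3. split; [|exact K2].
    symmetry. apply D3. split.
    + now rewrite <- comp_assoc, K1.
    + now rewrite comp_assoc, Sq, <- comp_assoc, K2.
Qed.

(** * Units of reflections into [M] lie in [E] *)

Section Bfc.

Variable C : bfc.

(** The first factor [e] of a factorization of [p] has the same universal property as [u]. Comparing
    the two gives [h] and [d] that exhibit [u] as a retract of [e], and orthogonality to [M] passes
    to retracts. *)
Lemma universal_arrow_clsE (Y : C) (p r : slice Y) (u : hom p r) :
  clsM (smap r) ->
  (forall q : slice Y, clsM (smap q) ->
     forall g : hom p q, exists! h : hom r q, h ∘ u = g) ->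
  clsE (proj1_sig u).
Proof.
  intros Mr U.
  destruct (fs_factor (bfc_fs C) (smap p)) as [Z [e [m [Ee [Mm F]]]]].
  destruct (U (SliceOb m) Mm (exist _ e (eq_sym F))) as [[h Eh] [Hh _]].
  apply (f_equal (@proj1_sig _ _)) in Hh; simpl in h, Eh, Hh.
  assert (S : smap r ∘ proj1_sig u = m ∘ e) by now rewrite (proj2_sig u).
  destruct (proj1 (fs_left (bfc_fs C) e) Ee _ _ _ Mr _ _ S) as [d [[D1 D2] _]].
  (* Both sides are endomorphisms of [r] over [Y] that fix [u], so universality of [u] equates
     them. *)
  assert (DH : d ∘ h = idm (sdom r)).
  { set (d' := exist _ d D2 : slice_hom (SliceOb m) r).
    assert (K : @comp (slice Y) r (SliceOb m) r d' (exist _ h Eh) = idm r).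
    { destruct (U r Mr u) as [w [_ Hw]].
      transitivity w; [symmetry|]; apply Hw; apply slice_hom_eq; simpl.
      - now rewrite <- comp_assoc, Hh.
      - apply comp_idl. }
    exact (f_equal (@proj1_sig _ _) K). }
  (* The square for [u] becomes one for [e] after precomposing its bottom edge with [d]; its filler
     [k] is carried back along [h]. *)
  apply (fs_left (bfc_fs C)). intros X' Y' m' Mm' a v E.
  assert (E' : m' ∘ a = (v ∘ d) ∘ e) by now rewrite <- comp_assoc, D1.
  destruct (proj1 (fs_left (bfc_fs C) e) Ee _ _ _ Mm' _ _ E') as [k [[K1 K2] K3]].
  exists (k ∘ h). split; [split|].
  - now rewrite <- comp_assoc, Hh.
  - now rewrite comp_assoc, K2, <- comp_assoc, DH, comp_idr.
  - intros k' [L1 L2]. rewrite (K3 (k' ∘ d)).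
    + now rewrite <- comp_assoc, DH, comp_idr.
    + split; [now rewrite <- comp_assoc, D1 | now rewrite comp_assoc, L2].
Qed.

Lemma down_unit_clsE (X : C) (down : functor (slice X) (sliceM X))
    (adj : adjunction down (inclM X)) (p : slice X) :
  clsE (proj1_sig (adj_unit adj p)).
Proof.
  apply universal_arrow_clsE; [exact (proj2_sig (down p))|].
  intros q Mq g. exact (adj_unit_universal adj (b := exist _ q Mq) g).
Qed.

Section Exists.

Variables (X Y : C) (f : hom X Y) (ex : functor (sliceM X) (sliceM Y)).
Variable adj : adjunction ex (pullbackM f).

(** The unit lands in a base change; projecting it to the second leg gives a map over [f], the
    candidate first factor of [f ∘ m]. *)
Definition exists_unit (m : sliceM X) :
    hom (sdom (proj1_sig m)) (sdom (proj1_sig (ex m))) :=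
  pr2 (bfc_lim C) f (smap (proj1_sig (ex m))) ∘ proj1_sig (adj_unit adj m).

Lemma exists_unit_comm (m : sliceM X) :
  smap (proj1_sig (ex m)) ∘ exists_unit m = f ∘ smap (proj1_sig m).
Proof.
  unfold exists_unit.
  rewrite comp_assoc, <- (pullback_comm (pb_pullback (bfc_lim C) f _)),
    <- comp_assoc.
  f_equal. exact (proj2_sig (adj_unit adj m)).
Qed.

Lemma exists_unit_natural (m m' : sliceM X) (u : hom m m') :
  proj1_sig (fmap ex u) ∘ exists_unit m = exists_unit m' ∘ proj1_sig u.
Proof.
  unfold exists_unit. rewrite <- (comp_assoc (pr2 _ _ _)).
  transitivity (pr2 (bfc_lim C) f (smap (proj1_sig (ex m'))) ∘
    (proj1_sig (fmap (pullbackM f) (fmap ex u)) ∘ proj1_sig (adj_unit adj m))).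
  - simpl. rewrite !comp_assoc. f_equal. symmetry. apply pr2_lift.
  - f_equal. exact (f_equal (@proj1_sig _ _) (adj_unit_natural adj u)).
Qed.

(** Maps over [Y] from [f ∘ m] to [q] correspond to maps over [X] from [m] to the base change of
    [q]. Through this correspondence the universality of the adjunction unit makes [exists_unit m] a
    reflection of [f ∘ m] into [M/Y]. *)
Lemma exists_unit_clsE (m : sliceM X) : clsE (exists_unit m).
Proof.
  pose (u := exist _ (exists_unit m) (exists_unit_comm m) :
    slice_hom (SliceOb (f ∘ smap (proj1_sig m))) (proj1_sig (ex m))).
  apply (universal_arrow_clsE (u := u)); [exact (proj2_sig (ex m))|].
  intros q Mq [g Hg]; simpl in g, Hg.
  assert (E : f ∘ smap (proj1_sig m) = smap q ∘ g) by now symmetry.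
  pose (g' := exist _ (pb_lift (bfc_lim C) E) (pr1_lift (bfc_lim C) E) :
    slice_hom (proj1_sig m) (base_change (bfc_lim C) f q)).
  destruct (adj_unit_universal adj (b := exist _ q Mq) g') as [h [H1 H2]].
  exists h. split.
  - apply slice_hom_eq; simpl. unfold exists_unit.
    apply (f_equal (@proj1_sig _ _)) in H1; simpl in H1.
    apply (f_equal (comp (pr2 (bfc_lim C) f (smap q)))) in H1.
    rewrite pr2_lift, comp_assoc, pr2_lift, <- comp_assoc in H1. exact H1.
  - intros k K. apply H2.
    apply (f_equal (@proj1_sig _ _)) in K; simpl in K.
    unfold exists_unit in K.
    apply slice_hom_eq, pb_ext; simpl.
    + rewrite comp_assoc, !pr1_lift. exact (proj2_sig (adj_unit adj m)).
    + now rewrite comp_assoc, !pr2_lift, <- comp_assoc.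
Qed.

End Exists.

(** * Maps of fibre products inverted by [pi0] *)

Lemma pi0_inverts_clsE (pi0 : functor C (catS C)) (adj : adjunction pi0 (inclS C))
    (A B : C) (e : hom A B) :
  clsE e -> is_iso (fmap pi0 e).
Proof.
  intros Ee. apply (left_adjoint_inverts adj). intros [q Mq] g; simpl in *.
  destruct (one_terminal (bfc_lim C) B) as [t _].
  destruct (proj1 (fs_left (bfc_fs C) e) Ee _ _ _ Mq g t (terminal_eq _ _))
    as [d [[D1 _] D3]].
  exists d. split; [exact D1|].
  intros k K. apply D3. split; [exact K | apply terminal_eq].
Qed.

(* The map between fibre products is the pullback of [e] along the second
   projection of [smap n] and [smap q], which lies in M'. *)
Lemma fibre_map_clsE (X Y : C) (f : hom X Y) (n' p : slice X) (n q : slice Y)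
    (g : hom (sdom n') (sdom n)) (e : hom (sdom p) (sdom q))
    (a : hom (pb (bfc_lim C) (smap n') (smap p)) (pb (bfc_lim C) (smap n) (smap q))) :
  is_pullback f (smap n) (smap n') g -> clsM' (smap n) ->
  smap q ∘ e = f ∘ smap p -> clsE e ->
  pr1 (bfc_lim C) (smap n) (smap q) ∘ a = g ∘ pr1 (bfc_lim C) (smap n') (smap p) ->
  pr2 (bfc_lim C) (smap n) (smap q) ∘ a = e ∘ pr2 (bfc_lim C) (smap n') (smap p) ->
  clsE a.
Proof.
  intros PB Mn He Ee A1 A2.
  pose proof (pullback_comm (pb_pullback (bfc_lim C) (smap n) (smap q))) as Sq.
  pose proof (fs_right_pullback (bfc_fs' C) (pb_pullback (bfc_lim C) _ (smap q)) Mn)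
    as M2.
  apply (reciprocal_stability (f := e) (g := pr2 (bfc_lim C) (smap n) (smap q))
    (p := pr2 (bfc_lim C) (smap n') (smap p))); [|exact Ee|exact M2].
  split; [now symmetry|].
  intros T x y E.
  (* The square [PB] yields the component [w] into [sdom n']; [W1] says that [w] and [x] agree over
     [X], so they pair into the fibre product. *)
  assert (E1 : f ∘ (smap p ∘ x) = smap n ∘ (pr1 (bfc_lim C) (smap n) (smap q) ∘ y)).
  { now rewrite !comp_assoc, Sq, <- He, <- !comp_assoc, E. }
  destruct (pullback_univ PB E1) as [w [[W1 W2] W3]].
  exists (pb_lift (bfc_lim C) W1). split; [split|].
  - apply pr2_lift.
  - apply pb_ext; rewrite comp_assoc.
    + now rewrite A1, <- comp_assoc, pr1_lift.
    + now rewrite A2, <- comp_assoc, pr2_lift.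
  - intros k [K1 K2]. apply pb_ext; [rewrite pr1_lift | now rewrite pr2_lift].
    apply W3. split.
    + now rewrite comp_assoc, (pullback_comm (pb_pullback _ _ _)), <- comp_assoc, K1.
    + now rewrite comp_assoc, <- A1, <- comp_assoc, K2.
Qed.

(** The common form of the three claims: [D] carries the variables, [g] is a cartesian comparison of
    the [M'] arguments over [f], and [e] compares the other arguments by maps in [E]. *)
Lemma tensor_bar_iso (pi0 : functor C (catS C)) (adj : adjunction pi0 (inclS C))
    (D : category) (X Y : C) (f : hom X Y)
    (F : functor D (slice X ⨉ slice X)) (G : functor D (slice Y ⨉ slice Y))
    (g : forall d, hom (sdom (fst (F d))) (sdom (fst (G d))))
    (e : forall d, hom (sdom (snd (F d))) (sdom (snd (G d)))) :
  (forall d, is_pullback f (smap (fst (G d))) (smap (fst (F d))) (g d)) ->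
  (forall d, clsM' (smap (fst (G d)))) ->
  (forall d, smap (snd (G d)) ∘ e d = f ∘ smap (snd (F d))) ->
  (forall d, clsE (e d)) ->
  (forall d d' (u : hom d d'),
     proj1_sig (fst (fmap G u)) ∘ g d = g d' ∘ proj1_sig (fst (fmap F u))) ->
  (forall d d' (u : hom d d'),
     proj1_sig (snd (fmap G u)) ∘ e d = e d' ∘ proj1_sig (snd (fmap F u))) ->
  tensor_bar pi0 X ⊚ F ≅ tensor_bar pi0 Y ⊚ G.
Proof.
  intros PB Mn He Ee Ng Ne.
  assert (S : forall d,
    smap (fst (G d)) ∘ (g d ∘ pr1 (bfc_lim C) (smap (fst (F d))) (smap (snd (F d)))) =
    smap (snd (G d)) ∘ (e d ∘ pr2 (bfc_lim C) (smap (fst (F d))) (smap (snd (F d))))).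
  { intros d. rewrite !comp_assoc, He, <- (pullback_comm (PB d)), <- !comp_assoc.
    f_equal. apply (pullback_comm (pb_pullback _ _ _)). }
  exists (fun d => fmap pi0 (pb_lift (bfc_lim C) (S d))). split.
  - intros d. apply (pi0_inverts_clsE adj).
    exact (fibre_map_clsE (PB d) (Mn d) (He d) (Ee d)
             (pr1_lift _ (S d)) (pr2_lift _ (S d))).
  - intros d d' u.
    refine (eq_trans (eq_sym (fmap_comp pi0 _ _)) (eq_trans _ (fmap_comp pi0 _ _))).
    f_equal. simpl.
    apply pb_ext; rewrite !comp_assoc.
    + rewrite !pr1_lift, <- !comp_assoc, !pr1_lift, !comp_assoc. now rewrite Ng.
    + rewrite !pr2_lift, <- !comp_assoc, !pr2_lift, !comp_assoc. now rewrite Ne.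
Qed.

End Bfc.

Unset Implicit Arguments.
Set Strict Implicit.

Theorem proposition8p1 (C : bfc) (C_strong : strong C)
  (pi0 : functor C (catS C)) (pi0_adj : adjunction pi0 (inclS C))
  (down : forall X : C, functor (slice X) (sliceM X))
  (down_adj : forall X : C, adjunction (down X) (inclM X))
  (ex : forall (X Y : C) (f : hom X Y), functor (sliceM X) (sliceM Y))
  (ex_adj : forall (X Y : C) (f : hom X Y), adjunction (ex X Y f) (pullbackM f)) :
  (forall X : C,
     tensor_bar pi0 X ⊚ functor_prod (inclM' X) (functor_id (slice X))
     ≅ tensor pi0 X ⊚ functor_prod (functor_id (sliceM' X)) (down X))
  /\
  (forall (X Y : C) (f : hom X Y),
     tensor pi0 X ⊚ functor_prod (pullbackM' f) (functor_id (sliceM X))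
     ≅ tensor pi0 Y ⊚ functor_prod (functor_id (sliceM' Y)) (ex X Y f))
  /\
  (forall (X Y : C) (e : hom X Y), clsE e ->
     tensor pi0 X ⊚ functor_pair (pullbackM' e) (functor_const (sliceM' Y) (identM X))
     ≅ tensor pi0 Y ⊚ functor_pair (functor_id (sliceM' Y))
                                    (functor_const (sliceM' Y) (identM Y))).
Proof.
  split; [|split].
  - intros X.
    (* Reassociating the composites in [tensor] alters only the proofs of functoriality, which a
       natural isomorphism does not mention; the same holds in the other two cases. *)
    apply (tensor_bar_iso pi0_adj (f := idm X)
      (F := functor_prod (inclM' X) (functor_id (slice X)))
      (G := functor_prod (inclM' X) (inclM X)
              ⊚ functor_prod (functor_id (sliceM' X)) (down X))
      (g := fun d => idm _)
      (e := fun d => proj1_sig (adj_unit (down_adj X) (snd d)))).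
    + intros d. apply is_pullback_idm.
    + intros d. exact (proj2_sig (fst d)).
    + intros d. rewrite comp_idl. exact (proj2_sig (adj_unit (down_adj X) (snd d))).
    + intros d. apply down_unit_clsE.
    + intros d d' u. now rewrite comp_idl, comp_idr.
    + intros d d' u.
      exact (f_equal (@proj1_sig _ _) (adj_unit_natural (down_adj X) (snd u))).
  - intros X Y f.
    apply (tensor_bar_iso pi0_adj (f := f)
      (F := functor_prod (inclM' X) (inclM X)
              ⊚ functor_prod (pullbackM' f) (functor_id (sliceM X)))
      (G := functor_prod (inclM' Y) (inclM Y)
              ⊚ functor_prod (functor_id (sliceM' Y)) (ex X Y f))
      (g := fun d => pr2 (bfc_lim C) f (smap (proj1_sig (fst d))))
      (e := fun d => exists_unit (ex_adj X Y f) (snd d))).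
    + intros d. apply pb_pullback.
    + intros d. exact (proj2_sig (fst d)).
    + intros d. apply exists_unit_comm.
    + intros d. apply exists_unit_clsE.
    (* Naturality of the projection is the equation that defines [base_change] on morphisms. *)
    + intros d d' u. symmetry. apply pr2_lift.
    + intros d d' u. exact (exists_unit_natural (ex_adj X Y f) (snd u)).
  - intros X Y e Ee.
    apply (tensor_bar_iso pi0_adj (f := e)
      (F := functor_prod (inclM' X) (inclM X)
              ⊚ functor_pair (pullbackM' e) (functor_const (sliceM' Y) (identM X)))
      (G := functor_prod (inclM' Y) (inclM Y)
              ⊚ functor_pair (functor_id (sliceM' Y))
                  (functor_const (sliceM' Y) (identM Y)))
      (g := fun d => pr2 (bfc_lim C) e (smap (proj1_sig d)))
      (e := fun d => e)).
    + intros d. apply pb_pullback.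
    + intros d. exact (proj2_sig d).
    + intros d. simpl. now rewrite comp_idl, comp_idr.
    + intros d. exact Ee.
    + intros d d' u. symmetry. apply pr2_lift.
    + intros d d' u. simpl. now rewrite comp_idl, comp_idr.
Qed.
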